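(* Let $\phi:\mathbb{R}^n\to\mathbb{R}\cup\{\infty\}$ be proper, closed and $\lambda$-strongly convex with $\lambda>0$, and assume that there is an open, convex set $U$ containing $\mathrm{dom}\,\phi$. Let $f(\cdot;s)$ be convex for all $s\in\mathcal{S}$. Assume that for all $s\in\mathcal{S}$ there exists $G_s\in\mathbb{R}_+$ such that $\mathsf{G}:=\sqrt{\mathbb{E}[G_S^2]}<\infty$ and $\|g\|\le G_s$ for all $x\in U$ and all $g\in\partial f(x;s)$. Let $x^\star=\arg\min_x\psi(x)$. Let $\{x^k\}_{k=0,\dots,K}$ be generated by the algorithm ProxSPS with step sizes $\alpha_k=\frac{2}{\lambda(k+1)}$. Then $$\mathbb{E}\Big[\psi\Big(\tfrac{2}{(K+1)(K+2)-2}\sum_{k=1}^K(k+1)x^k\Big)-\psi(x^\star)\Big]\le\frac{\lambda}{(K+1)^2}\|x^0-x^\star\|^2+\frac{8\mathsf{G}^2}{\lambda(K+1)}.$$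
   Context: Setting. $S$ is a random variable with values in a sample space $\mathcal{S}$ and distribution $P$; $\mathbb{E}$ denotes expectation, $\mathbb{E}[X(S)]=\int_{\mathcal{S}}X(s)\,dP(s)$. For each $s\in\mathcal{S}$, $f(\cdot;s):\mathbb{R}^n\to\mathbb{R}$ is locally Lipschitz with Clarke subdifferential $\partial f(\cdot;s)$ (for convex functions, the usual convex subdifferential), and $f(x):=\mathbb{E}[f(x;S)]$ is real-valued on $\mathbb{R}^n$. For $\phi:\mathbb{R}^n\to\mathbb{R}\cup\{\infty\}$ put $\psi:=f+\phi$. For every $s$, $\inf_xf(x;s)$ is finite and a number $C(s)\le\inf_xf(x;s)$ is given. Infinitely many i.i.d. realizations $S_0,S_1,\dots$ distributed as $S$ can be drawn. Algorithm ProxSPS. Given $x^0\in\mathbb{R}^n$ and step sizes $\alpha_k>0$, for $k=0,1,\dots,K-1$ (with $K\ge1$): sample $S_k\sim P$ independently of the past, choose $g_k\in\partial f(x^k;S_k)$, and set $$x^{k+1}=\arg\min_{y\in\mathbb{R}^n}\ \max\{f(x^k;S_k)+\langle g_k,y-x^k\rangle,\,C(S_k)\}+\phi(y)+\frac{1}{2\alpha_k}\|y-x^k\|^2 .$$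
   Formalization: The formal theorem additionally assumes that the starting point x^0 lies in U; for arbitrary x^0 in R^n the claim is false, since the first subgradient is then not controlled by G_s. *)

(* Defs.v *)
From HB Require Import structures.
From mathcomp Require Import all_boot all_order all_algebra.
From mathcomp Require Import all_classical all_reals all_analysis.

Set Implicit Arguments.
Unset Strict Implicit.
Unset Printing Implicit Defensive.

Import Order.TTheory GRing.Theory Num.Theory.
Import numFieldNormedType.Exports.

Local Open Scope classical_set_scope.
Local Open Scope ring_scope.

Definition dot (R : realType) (n : nat) (u v : 'rV[R]_n) : R :=
  \sum_(i < n) u 0 i * v 0 i.

(* The library norm on ['rV[R]_n] is the sup norm; it induces the same topology
   but is not the norm of the statement. *)
Definition enorm (R : realType) (n : nat) (u : 'rV[R]_n) : R :=
  Num.sqrt (dot u u).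

Definition borelRn (R : realType) (n : nat) :=
  g_sigma_algebraType (@open 'rV[R]_n).

Definition locally_lipschitz (R : realType) (n : nat) (h : 'rV[R]_n -> R) :
    Prop :=
  forall x : 'rV[R]_n, exists (V : set 'rV[R]_n) (L : R), nbhs x V /\
    forall y z, V y -> V z -> `|h y - h z| <= L * enorm (y - z).

(* Convex subdifferential; it coincides with the Clarke subdifferential when
   [h] is convex, which is the only case used. *)
Definition subdiff (R : realType) (n : nat) (h : 'rV[R]_n -> R)
    (x : 'rV[R]_n) : set 'rV[R]_n :=
  [set g | forall y, h x + dot g (y - x) <= h y].

Definition eff_dom (R : realType) (n : nat) (phi : 'rV[R]_n -> \bar R) :
    set 'rV[R]_n :=
  [set x | (phi x < +oo)%E].

Definition proper_fun (R : realType) (n : nat) (phi : 'rV[R]_n -> \bar R) : Prop :=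
  (forall x, phi x != -oo%E) /\ eff_dom phi !=set0.

(* closedness of the epigraph *)
Definition closed_fun (R : realType) (n : nat) (phi : 'rV[R]_n -> \bar R) :
    Prop :=
  closed [set p : 'rV[R]_n * R | (phi p.1 <= p.2%:E)%E].

Definition strongly_convex (R : realType) (n : nat) (lambda : R)
    (phi : 'rV[R]_n -> \bar R) : Prop :=
  forall (x y : 'rV[R]_n) (t : R), 0 <= t <= 1 ->
    (phi (t *: x + (1 - t) *: y)%R <=
     t%:E * phi x + (1 - t)%:E * phi y
     - (lambda / 2 * t * (1 - t) * enorm (x - y) ^+ 2)%:E)%E.

Definition is_argmin (R : realType) (n : nat) (h : 'rV[R]_n -> \bar R)
    (x : 'rV[R]_n) : Prop :=
  forall y, (h x <= h y)%E.

(* [psi = f + phi], where [f x] is the mean of [f x s] for [s] drawn from [P] *)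
Definition objective (R : realType) (n : nat) (d : measure_display)
    (S : measurableType d) (P : probability S R) (f : 'rV[R]_n -> S -> R)
    (phi : 'rV[R]_n -> \bar R) (x : 'rV[R]_n) : \bar R :=
  ('E_P[f x] + phi x)%E.

(* The function minimised in one step from the current point [x], with sample
   [s], subgradient [g] and step size [alpha]. *)
Definition prox_model (R : realType) (n : nat) (T : Type)
    (f : 'rV[R]_n -> T -> R) (C : T -> R) (phi : 'rV[R]_n -> \bar R)
    (alpha : R) (s : T) (x g y : 'rV[R]_n) : \bar R :=
  ((Num.max (f x s + dot g (y - x)) (C s))%:E + phi y
   + (enorm (y - x) ^+ 2 / (2 * alpha))%:E)%E.

(* Sigma-algebra of everything generated before the [k]-th sample is drawn. *)
Definition history (R : realType) (n : nat) (dO dS : measure_display)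
    (Omega : measurableType dO) (S : measurableType dS)
    (Pr : probability Omega R) (xi : nat -> {RV Pr >-> S})
    (x g : nat -> {RV Pr >-> borelRn R n}) (k : nat) : set (set Omega) :=
  <<s [set E | (exists i (B : set (borelRn R n)),
                  [/\ (i <= k)%N, measurable B & E = x i @^-1` B])
            \/ (exists i (B : set (borelRn R n)),
                  [/\ (i < k)%N, measurable B & E = g i @^-1` B])
            \/ (exists i (B : set S),
                  [/\ (i < k)%N, measurable B & E = xi i @^-1` B])] >>.

(* [x 0, ..., x K] is produced by [K] steps of the method from [x0], with
   samples [xi k] and subgradients [g k].  As the history contains the earlier
   samples, [proxsps_indep] and [proxsps_law] make [xi 0, ..., xi K.-1] i.i.d.;
   [g k] may depend on the past, on [xi k] and on additional randomness, as
   long as later samples remain independent of it. *)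
Record ProxSPS (R : realType) (n : nat) (dO dS : measure_display)
    (Omega : measurableType dO) (S : measurableType dS)
    (Pr : probability Omega R) (P : probability S R)
    (f : 'rV[R]_n -> S -> R) (C : S -> R) (phi : 'rV[R]_n -> \bar R)
    (alpha : nat -> R) (x0 : 'rV[R]_n) (K : nat)
    (xi : nat -> {RV Pr >-> S}) (x g : nat -> {RV Pr >-> borelRn R n}) :
    Prop := {
  proxsps_step_gt0 : forall k, (k < K)%N -> 0 < alpha k ;
  proxsps_init : forall w, x 0%N w = x0 ;
  proxsps_law : forall k, (k < K)%N -> forall A, measurable A ->
    distribution Pr (xi k) A = P A ;
  proxsps_indep : forall k, (k < K)%N -> forall A E, measurable A ->
    history xi x g k E ->
    Pr (E `&` xi k @^-1` A) = (Pr E * Pr (xi k @^-1` A))%E ;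
  proxsps_subgrad : forall k, (k < K)%N -> forall w,
    subdiff (f^~ (xi k w)) (x k w) (g k w) ;
  proxsps_update : forall k, (k < K)%N -> forall w,
    is_argmin (prox_model f C phi (alpha k) (xi k w) (x k w) (g k w))
      (x k.+1 w)
}.

(* Main.v *)
Require Import Defs.
From HB Require Import structures.
From mathcomp Require Import all_boot all_order all_algebra.
From mathcomp Require Import all_classical all_reals all_analysis.
From mathcomp Require Import measurable_realfun.
From mathcomp Require Import ring lra.
Import Order.TTheory GRing.Theory Num.Theory.
Import numFieldNormedType.Exports.
Local Open Scope classical_set_scope.
Local Open Scope ring_scope.
Set Implicit Arguments.
Unset Strict Implicit.
Unset Printing Implicit Defensive.

(** Write [u_k] for the displacement from the [k]-th iterate to the next.  The
    function minimised in a step is strongly convex, with modulus [lambda] from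
    [phi] and [1/alpha_k] from the quadratic; [prox_step] compares its value at
    its minimizer with its value at [xstar].  For [alpha_k = 2/(lambda*(k+1))]
    the squared distances to [xstar] telescope once step [k] is weighted by
    [k+2], which is the weight of its outcome in the average, and [jensen_sum]
    passes from the weighted gaps of the iterates to the gap of the average.
    What remains is the noise, the sum over [k < K] of
      [(k+2) * (E f(x_(k+1)) - E f(x_k) - E <g_k, u_k> - E |u_k|^2/(2*alpha_k))].
    As the weights add up to [K*(K+3)/2], the asserted rate leaves room for a
    noise of [4*K + 8*K/(K+1)] in units of [V/lambda], with [V] the mean of
    [G^2].

    Estimating the ascent of [f] by the Lipschitz bound and the inner product by
    the bound on [g_k], step by step, gives [4*(k+2)/(k+1)] for step [k]; the
    sum is [4*K] plus four times a harmonic number and exceeds that room for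
    every [K >= 2].  The gain comes from looking at two consecutive steps.  For
    both to be as bad as the estimate, [f] must increase at full slope along
    [u_k], which by convexity forces the next subgradient to point along [u_k]
    in the mean ([gap_le_next_inner]), and [u_(k+1)] must be opposite to that
    subgradient.  Then the path turns back and the two ascents cannot add up,
    since the total ascent is bounded by the distance between the end points.
    Averaging the two estimates with the parallelogram law gives [pair_gap_le],
    and [noise_sum_le] shows that this is enough to fit the noise in.

    The Lipschitz bound on [f] is obtained in [subgradient_bound] from the
    subgradients at nearby proximal points.  That the [k]-th sample can be
    integrated out with the [k]-th or an earlier iterate held fixed is Fubini's
    theorem for their joint law ([indep_integral]), with joint measurability
    from [caratheodory_measurable].  The values of [phi] are eliminated
    pathwise: the integrand is nonnegative and below an integrable function in
    which [phi] no longer occurs ([ge0_integral_le]). *)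

(** * Inner product and Euclidean norm *)

Section InnerProduct.
Context {R : realType} {n : nat}.
Implicit Types (u v w : 'rV[R]_n) (t : R).

Lemma dotC u v : dot u v = dot v u.
Proof. by apply: eq_bigr => i _; rewrite mulrC. Qed.

Lemma dotDl u v w : dot (u + v) w = dot u w + dot v w.
Proof. by rewrite -big_split; apply: eq_bigr => i _; rewrite mxE mulrDl. Qed.

Lemma dotZl t u v : dot (t *: u) v = t * dot u v.
Proof. by rewrite mulr_sumr; apply: eq_bigr => i _; rewrite mxE mulrA. Qed.

Lemma dotNl u v : dot (- u) v = - dot u v.
Proof. by rewrite -scaleN1r dotZl mulN1r. Qed.

Lemma dotDr u v w : dot w (u + v) = dot w u + dot w v.
Proof. by rewrite dotC dotDl !(dotC w). Qed.

Lemma dotZr t u v : dot v (t *: u) = t * dot v u.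
Proof. by rewrite dotC dotZl dotC. Qed.

Lemma dotNr u v : dot v (- u) = - dot v u.
Proof. by rewrite dotC dotNl dotC. Qed.

Definition dotE := (dotDl, dotDr, dotNl, dotNr, dotZl, dotZr).

Lemma dot_ge0 u : 0 <= dot u u.
Proof. by apply: sumr_ge0 => i _; rewrite -expr2 sqr_ge0. Qed.

Lemma enorm_ge0 u : 0 <= enorm u. Proof. exact: sqrtr_ge0. Qed.

Lemma sqr_enorm u : enorm u ^+ 2 = dot u u.
Proof. by rewrite sqr_sqrtr ?dot_ge0. Qed.

Lemma enorm0 : enorm (0 : 'rV[R]_n) = 0.
Proof. by rewrite /enorm /dot big1 ?sqrtr0// => i _; rewrite mxE mul0r. Qed.

Lemma parallelogram u v :
  enorm (u - v) ^+ 2 + enorm (u + v) ^+ 2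
  = 2 * (enorm u ^+ 2 + enorm v ^+ 2).
Proof. by rewrite !sqr_enorm !dotE (dotC v u); ring. Qed.

(** Young's inequality with a free weight takes the place of Cauchy-Schwarz
    throughout: it is linear in the squared norms, so it can be integrated. *)
Lemma dot_young t u v : 0 < t ->
  dot u v <= enorm u ^+ 2 / (4 * t) + t * enorm v ^+ 2.
Proof.
move=> t0; rewrite !sqr_enorm.
have := dot_ge0 (u - (2 * t) *: v); rewrite !dotE (dotC v u) => h.
have t4 : 0 < 4 * t by lra.
rewrite -subr_ge0 -(pmulr_rge0 _ t4).
suff -> : 4 * t * (dot u u / (4 * t) + t * dot v v - dot u v)
  = dot u u - 2 * t * dot u v - (2 * t) * (dot u v - 2 * t * dot v v) by lra.
by field; lra.
Qed.

End InnerProduct.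

(** * Balancing the noise of consecutive steps *)

Section Budget.
Context {R : realType}.

(** Grouping the steps in pairs from the end, and leaving the very first step
    alone when their number is odd, fits inside the budget [4K + 8K/(K+1)]. *)
Lemma paired_sum_le (nu : nat -> R) (B : R) (K : nat) : 0 <= B ->
  (0 < K)%N -> nu 0%N <= 8 * B ->
  (forall j, (j.+2 <= K)%N ->
     nu j + nu j.+1 <= (6 + 4 / (j%:R + 1) + 4 / (j%:R + 2)) * B) ->
  \sum_(0 <= k < K) nu k <= (4 * K%:R + 8 * K%:R / (K%:R + 1)) * B.
Proof.
move=> B0 K0 nu0.
(* Pairing makes this an induction by steps of two: it carries the bound for
   two consecutive lengths. *)
suff H k : (k <= K)%N ->
    (forall j, (j.+2 <= k)%N ->
     nu j + nu j.+1 <= (6 + 4 / (j%:R + 1) + 4 / (j%:R + 2)) * B) ->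
    \sum_(0 <= i < k) nu i <= (4 * k%:R + 8 * k%:R / (k%:R + 1)) * B /\
    ((k < K)%N -> (forall j, (j.+2 <= k.+1)%N ->
     nu j + nu j.+1 <= (6 + 4 / (j%:R + 1) + 4 / (j%:R + 2)) * B) ->
    \sum_(0 <= i < k.+1) nu i
      <= (4 * k.+1%:R + 8 * k.+1%:R / (k.+1%:R + 1)) * B).
  by move=> h; have [] := H _ (leqnn K) h.
elim: k => [|k IH] kK h.
  rewrite big_geq// big_nat1 !mulr0 mul0r addr0 mul0r; split=> // _ _.
  apply: le_trans nu0 _; rewrite ler_wpM2r//.
  have -> : (8 * 1%:R / (1%:R + 1) : R) = 4 by field.
  by lra.
have [h1 h2] := IH (ltnW kK) (fun j jk => h j (leqW jk)).
split; first exact: h2.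
move=> kK1 h3; rewrite !big_nat_recr//= -addrA.
apply: le_trans (lerD h1 (h3 k _)) _ => //.
rewrite -mulrDl ler_wpM2r// -(natr1 k.+1) -(natr1 k).
have : (0 : R) <= k%:R by [].
move: (k%:R) => z z0.
rewrite -subr_ge0.
have -> : 4 * (z + 1 + 1) + 8 * (z + 1 + 1) / (z + 1 + 1 + 1) -
   (4 * z + 8 * z / (z + 1) + (6 + 4 / (z + 1) + 4 / (z + 2))) =
  (2 * z ^+ 3 + 4 * z ^+ 2 + 2 * z + 8) / ((z + 1) * (z + 2) * (z + 3)).
  by field; apply/and3P; split; lra.
by rewrite divr_ge0//; nra.
Qed.

(** Here [e k] stands for the mean of [f] at the [k]-th iterate, [A k] for the
    mean squared length of the [k]-th displacement and [c k] for its mean inner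
    product with the [k]-th subgradient.  Bounding [e k.+1 - e k] and [- c k]
    separately in every step would cost [4K] plus four times a harmonic sum,
    which exceeds the budget.  Both bounds cannot be tight in two steps running:
    by [pair_le], an ascent of [f] along one displacement shows up in the next
    subgradient, and if the next displacement turns back then the ascents do
    not add up. *)
Lemma noise_sum_le (e c A : nat -> R) (V lambda : R) (K : nat)
    (V0 : 0 <= V) (lambda0 : 0 < lambda) (A0 : forall k, 0 <= A k)
    (K0 : (0 < K)%N)
    (ascent_le : forall k t, (k < K)%N -> 0 < t ->
       e k.+1 - e k <= V / (4 * t) + t * A k)
    (inner_le : forall k t, (k < K)%N -> 0 < t -> - c k <= V / (4 * t) + t * A k)
    (pair_le : forall k t, (k.+1 < K)%N -> 0 < t ->
       (e k.+1 - e k) - c k.+1 + (e k.+2 - e k)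
       <= V / (2 * t) + 2 * t * (A k + A k.+1)) :
  \sum_(0 <= k < K) (k%:R + 2) *
     (e k.+1 - e k - c k - lambda * (k%:R + 1) / 4 * A k)
  <= (4 * K%:R + 8 * K%:R / (K%:R + 1)) * (V / lambda).
Proof.
apply: paired_sum_le => //; first by rewrite divr_ge0// ltW.
  have l8 : 0 < lambda / 8 by lra.
  have := ascent_le 0%N _ K0 l8; have := inner_le 0%N _ K0 l8.
  have -> : V / (4 * (lambda / 8)) = 2 * (V / lambda) by field; lra.
  set W := V / lambda; rewrite add0r => h1 h2; nra.
move=> j jK; rewrite -(natr1 j).
have j0 : (0 : R) <= j%:R by [].
move: (pair_le j) (ascent_le j.+1) (inner_le j) (inner_le j.+1).
move: (j%:R) j0 => z z0 hp ha hi1 hi2.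
(* The weight [lambda * (z + 1) / 8] spends half of the quadratic term of step
   [j] on the pair and the other half on its inner product; step [j.+1] has room
   for [lambda * (z + 2) / 8] beside its share of the pair. *)
have l1 : 0 < lambda * (z + 1) / 8 by nra.
have l2 : 0 < lambda * (z + 2) / 8 by nra.
have {}hp := hp _ jK l1; have {}ha := ha _ jK l2.
have {}hi1 := hi1 _ (ltnW jK) l1; have {}hi2 := hi2 _ jK l2.
have E1 : V / (2 * (lambda * (z + 1) / 8)) = 4 / (z + 1) * (V / lambda).
  by field; apply/andP; split; lra.
have E2 : V / (4 * (lambda * (z + 1) / 8)) = 2 / (z + 1) * (V / lambda).
  by field; apply/andP; split; lra.
have E3 : V / (4 * (lambda * (z + 2) / 8)) = 2 / (z + 2) * (V / lambda).
  by field; apply/andP; split; lra.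
rewrite {}E1 in hp; rewrite {}E2 in hi1; rewrite {}E3 in ha hi2.
(* The pair estimate counts the first ascent twice, so half the weight [z + 2]
   of step [j] covers it; of the weight [z + 3] of step [j.+1] there remains
   [(z + 4) / 2]. *)
have h1 := ler_wpM2l (_ : 0 <= (z + 2) / 2) hp.
have h2 := ler_wpM2l (_ : 0 <= (z + 4) / 2) (lerD ha hi2).
have h3 := ler_wpM2l (_ : 0 <= z + 2) hi1.
have := lerD (lerD (h1 _) (h2 _)) (h3 _); rewrite {h1 h2 h3}.
move=> /(_ ltac:(lra) ltac:(lra) ltac:(lra)) h.
set W := V / lambda in h *.
have hA : 0 <= lambda * (z + 2) / 8 * A j.+1 by rewrite mulr_ge0// ltW.
have EW : (z + 2) / 2 * (4 / (z + 1) * W) + (z + 4) / 2 * (2 * (2 / (z + 2) * W))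
    + (z + 2) * (2 / (z + 1) * W) = (6 + 4 / (z + 1) + 4 / (z + 2)) * W.
  by field; apply/andP; split; lra.
lra.
Qed.

End Budget.

(** * Convex functions on Euclidean space *)

Section Convex.
Context {R : realType} {n : nat}.
Implicit Types (u v w x y z : 'rV[R]_n) (h : 'rV[R]_n -> R) (t r : R).

Lemma convex_functionP h :
  convex_function [set: convex_lmodType 'rV[R]_n] h ->
  forall x y t, 0 <= t <= 1 ->
    h (t *: x + (1 - t) *: y) <= t * h x + (1 - t) * h y.
Proof.
move=> hc x y t /andP[t0 t1].
by have := hc (Itv01 t0 t1) x y; rewrite !inE/=; exact.
Qed.

Lemma ge0_of_affine (a b : R) :
  (forall t, 0 < t < 1 -> 0 <= a + t * b) -> 0 <= a.
Proof.
move=> h; rewrite leNgt; apply/negP => a0.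
have hb : b <= `|b| := ler_norm b.
have b0 : 0 <= `|b| := normr_ge0 b.
set D := - a + (`|b| + 1).
have D0 : 0 < D by rewrite /D; lra.
have := h (- a / D); rewrite divr_gt0 ?oppr_gt0// ltr_pdivrMr// mul1r.
move=> /(_ ltac:(rewrite /D; lra)).
have -> : a + - a / D * b = - a * (b - `|b| - 1 + a) / D.
  by rewrite /D; field; rewrite lt0r_neq0.
rewrite leNgt => /negP; apply.
by rewrite ltr_pdivrMr// mul0r pmulr_rlt0 ?oppr_gt0//; lra.
Qed.

Lemma convex_comb_sub x y z t :
  t *: x + (1 - t) *: y - z = (y - z) + t *: (x - y).
Proof. by apply/rowP => i; rewrite !mxE; ring. Qed.

Lemma sqr_enormD u v t : enorm (u + t *: v) ^+ 2
  = enorm u ^+ 2 + 2 * t * dot u v + t ^+ 2 * enorm v ^+ 2.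
Proof. by rewrite !sqr_enorm !dotE (dotC v u); ring. Qed.

(** Moving [z] by a fraction [t] towards [v] changes the quadratic, to first
    order in [t], by an inner product with [z - y]; convexity bounds the change
    of [h] by [t * (h v - h z)].  Minimality of [z] forbids a decrease. *)
Lemma prox_subdiff h y z r :
  (forall u v t, 0 <= t <= 1 ->
    h (t *: u + (1 - t) *: v) <= t * h u + (1 - t) * h v) ->
  (forall v, h z + r * enorm (z - y) ^+ 2 <= h v + r * enorm (v - y) ^+ 2) ->
  subdiff h z ((2 * r) *: (y - z)).
Proof.
move=> hc zmin v; rewrite dotZl -opprB dotNl.
rewrite -subr_ge0; apply: (@ge0_of_affine _ (r * enorm (v - z) ^+ 2)) => t t01.
have t0 : 0 < t by case/andP: t01.
have := zmin (t *: v + (1 - t) *: z); rewrite convex_comb_sub sqr_enormD.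
have := hc v z t; have -> : 0 <= t <= 1 by case/andP: t01 => *; rewrite !ltW.
move=> /(_ isT); rewrite -(pmulr_rge0 _ t0).
set a := enorm (z - y) ^+ 2; set b := enorm (v - z) ^+ 2; set d := dot _ _.
move=> h1 h2; lra.
Qed.

Lemma normr_le_enorm u : `|u| <= enorm u.
Proof.
rewrite [leLHS]/Num.norm/= mx_normrE; apply/bigmax_leP; split => [|[i j] _]/=.
  exact: enorm_ge0.
rewrite ord1 -sqrtr_sqr ler_wsqrtr// /dot (bigD1 j)//= -expr2 lerDl.
by apply: sumr_ge0 => k _; rewrite -expr2 sqr_ge0.
Qed.

Lemma sqr_enormB_continuous y : continuous (fun v => enorm (v - y) ^+ 2).
Proof.
have -> : (fun v => enorm (v - y) ^+ 2) =
    (fun v => \sum_(i < n) (v 0 i - y 0 i) * (v 0 i - y 0 i)).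
  by apply/funext => v; rewrite sqr_enorm; apply: eq_bigr => i _; rewrite !mxE.
have c i : continuous (fun u : 'rV[R]_n => u 0 i - y 0 i).
  have ci : continuous (fun u : 'rV[R]_n => u 0 i) by exact: coord_continuous.
  by move=> v; apply: continuousB; [exact: ci|exact: cst_continuous].
apply: continuous_big => [|i _]; first exact: add_continuous.
have cc : continuous (fun u : 'rV[R]_n => (u 0 i - y 0 i) * (u 0 i - y 0 i)).
  by move=> v; apply: (@continuousM _ _ _ _ v (c i v) (c i v)).
exact: cc.
Qed.

Lemma locally_lipschitz_continuous h : locally_lipschitz h -> continuous h.
Proof.
move=> hl x; have [V [L [xV hV]]] := hl x.
have Vx : V x := nbhs_singleton xV.
pose B v := Num.max L 0 * enorm (v - x).
have Bx : B @ x --> B x.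
  have -> : B = (fun v => Num.max L 0 * Num.sqrt (enorm (v - x) ^+ 2)).
    by apply/funext => v; rewrite /B sqrtr_sqr ger0_norm ?enorm_ge0.
  have sc := continuous_comp (@sqr_enormB_continuous x x) (@sqrt_continuous R _).
  exact: (continuousM (@cst_continuous _ _ (Num.max L 0) x) sc).
apply/(@cvgrPdist_le _ _ _ (nbhs x)) => e e0.
have /cvgrPdist_le/(_ e e0) Be := Bx.
near=> v.
have Vv : V v by near: v.
apply: (@le_trans _ _ `|B x - B v|); last by near: v.
have -> : `|B x - B v| = Num.max L 0 * enorm (v - x).
  rewrite {1}/B subrr enorm0 mulr0 sub0r normrN ger0_norm//.
  by rewrite mulr_ge0 ?enorm_ge0// le_max lexx orbT.
rewrite distrC; apply: le_trans (hV _ _ Vv Vx) _.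
by rewrite ler_wpM2r ?enorm_ge0// le_max lexx.
Unshelve. all: by end_near. Qed.

Lemma sqr_enormC u v : enorm (u - v) ^+ 2 = enorm (v - u) ^+ 2.
Proof. by rewrite !sqr_enorm -opprB dotNl dotNr opprK. Qed.

Lemma nbhs_enorm y (N : set 'rV[R]_n) : nbhs y N ->
  exists2 e, 0 < e & forall v, enorm (v - y) ^+ 2 <= e -> N v.
Proof.
move=> /nbhs_normP[e/= e0 eN]; exists ((e / 2) ^+ 2); first by rewrite exprn_gt0// divr_gt0.
move=> v; rewrite ler_sqr ?nnegrE ?enorm_ge0//; last by rewrite ltW// divr_gt0.
move=> ve; apply: eN => /=; rewrite distrC.
apply: le_lt_trans (normr_le_enorm _) _; apply: le_lt_trans ve _.
by rewrite ltr_pdivrMr// mulr2n mulrDr mulr1 ltrDl.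
Qed.

(** The sublevel set of the quadratic beyond which [m] alone already exceeds
    [h y] is compact. *)
Lemma prox_exists h y r (m : R) : continuous h -> (forall v, m <= h v) -> 0 < r ->
  exists z, forall v, h z + r * enorm (z - y) ^+ 2 <= h v + r * enorm (v - y) ^+ 2.
Proof.
move=> hcont hm r0; set c := (h y - m) / r.
have c0 : 0 <= c by rewrite divr_ge0 ?subr_ge0// ltW.
pose A := [set v : 'rV[R]_n | enorm (v - y) ^+ 2 <= c].
have Ay : A y by rewrite /A/= subrr enorm0 expr0n.
have Acl : closed A.
  apply: (@preimage_closed _ _ (fun v => enorm (v - y) ^+ 2) [set e | e <= c]).
    by move=> v _; exact: sqr_enormB_continuous.
  exact: closed_le.
have Abd : bounded_set A.
  exists (`|y| + Num.sqrt c); split; first exact: num_real.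
  move=> M hM v Av; rewrite -(subrK y v) addrC.
  apply: le_trans (ler_normD _ _) _; apply: le_trans _ (ltW hM).
  rewrite lerD2l (le_trans (normr_le_enorm _))//.
  by rewrite -(ger0_norm (enorm_ge0 _)) -sqrtr_sqr ler_wsqrtr.
have Phi : continuous (fun v => h v + r * enorm (v - y) ^+ 2).
  move=> v; have c2 := continuousM (@cst_continuous _ _ r v) (@sqr_enormB_continuous y v).
  exact: (continuousD (hcont v) c2).
have [z _ zmin] := EVT_min_rV (ex_intro _ y Ay) (bounded_closed_compact Abd Acl)
  (continuous_subspaceT Phi).
exists z => v; have [Av|/negP nAv] := boolP (v \in A); first exact: zmin.
have /le_trans := zmin y (mem_set Ay); apply.
rewrite subrr enorm0 expr0n mulr0 addr0.
have : c < enorm (v - y) ^+ 2 by rewrite ltNge; apply/negP => ?; apply: nAv; exact: mem_set.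
rewrite ltr_pdivrMr// mulrC => /ltW; have := hm v.
by move=> h1 h2; lra.
Qed.

(** The proximal points of [y] converge to [y] and so end up in [U], and each
    of them carries a subgradient by [prox_subdiff].  The subgradient inequality
    there, weakened by Young's inequality, passes to the limit [y].  Optimizing
    [t] would give the Lipschitz bound with constant [G]. *)
Lemma subgradient_bound h (U : set 'rV[R]_n) (G m t : R) y z :
  (forall u v s, 0 <= s <= 1 ->
    h (s *: u + (1 - s) *: v) <= s * h u + (1 - s) * h v) ->
  continuous h -> (forall v, m <= h v) -> open U ->
  (forall u g, U u -> subdiff h u g -> enorm g <= G) ->
  U y -> 0 < t ->
  h y - h z <= G ^+ 2 / (4 * t) + t * enorm (y - z) ^+ 2.
Proof.
move=> hc hcont hm oU hG Uy t0; rewrite leNgt; apply/negP => hy.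
pose F v := h v - h z - t * enorm (v - z) ^+ 2.
have Fc : {for y, continuous F}.
  have c2 := continuousM (@cst_continuous _ _ t y) (@sqr_enormB_continuous z y).
  have c1 := continuousB (hcont y) (@cst_continuous _ _ (h z) y).
  exact: (continuousB c1 c2).
have Fy : G ^+ 2 / (4 * t) < F y by rewrite /F ltrBrDr.
have : \forall v \near y, U v /\ G ^+ 2 / (4 * t) < F v.
  near=> v; split.
    by near: v; exact: open_nbhs_nbhs.
  near: v; apply: (Fc (fun s => G ^+ 2 / (4 * t) < s)).
  by apply: open_nbhs_nbhs; split => //; exact: open_gt.
move=> /nbhs_enorm[e e0 eN].
have r0 : 0 < (h y - m) / e + 1.
  by rewrite ltr_wpDl// divr_ge0 ?subr_ge0// ltW.
(* For this [r] the proximal point [w] is within the radius [e] of [y]. *)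
have [w wmin] := prox_exists y hcont hm r0.
have wy : enorm (w - y) ^+ 2 <= e.
  have := wmin y; rewrite subrr enorm0 expr0n mulr0 addr0 => h1.
  have h2 := hm w.
  rewrite -(ler_pM2l r0); apply: (@le_trans _ _ (h y - m)); first by lra.
  rewrite mulrDl mul1r divfK ?lt0r_neq0//; lra.
have [Uw Fw] := eN _ wy.
have sg := prox_subdiff hc wmin.
have := sg z; have := hG _ _ Uw sg.
set g := (2 * _) *: _ => gG hz.
have := dot_young g (w - z) t0; move: hz Fw; rewrite /F -opprB dotNr => hz Fw hd.
have : enorm g ^+ 2 / (4 * t) <= G ^+ 2 / (4 * t).
  apply: ler_wpM2r; first by rewrite invr_ge0 mulr_ge0// ltW.
  by rewrite ler_sqr ?nnegrE ?enorm_ge0// (le_trans (enorm_ge0 _) gG).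
by move=> hgG; lra.
Unshelve. all: by end_near. Qed.

End Convex.

(** * Extended-valued strongly convex functions and one proximal step *)

Section StronglyConvex.
Context {R : realType} {n : nat}.
Variables (phi : 'rV[R]_n -> \bar R) (lambda : R).
Hypothesis phi_proper : proper_fun phi.
Hypothesis phi_convex : strongly_convex lambda phi.

Lemma eff_dom_fineK x : eff_dom phi x -> phi x = (fine (phi x))%:E.
Proof.
move=> xdom; rewrite fineK// fin_numE phi_proper.1/=.
by rewrite lt_eqF.
Qed.

Lemma strongly_convex_fine (x y : 'rV[R]_n) (t : R) :
  eff_dom phi x -> eff_dom phi y -> 0 <= t <= 1 ->
  eff_dom phi (t *: x + (1 - t) *: y) /\
  fine (phi (t *: x + (1 - t) *: y))
  <= t * fine (phi x) + (1 - t) * fine (phi y)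
     - lambda / 2 * t * (1 - t) * enorm (x - y) ^+ 2.
Proof.
move=> xD yD t01; have := phi_convex x y t01.
rewrite (eff_dom_fineK xD) (eff_dom_fineK yD) -!EFinM -!EFinD => h.
have zD : eff_dom phi (t *: x + (1 - t) *: y).
  exact: le_lt_trans h (ltry _).
by split=> //; move: h; rewrite (eff_dom_fineK zD) lee_fin.
Qed.

(** The three-point inequality, from comparing the minimizer with the points
    of the segment towards [y]: a [kappa]-strongly convex function exceeds its
    minimum by [kappa / 2] times the squared distance to the minimizer.  Here
    the linear model is bounded below at the minimizer by its affine part, and
    above at [y] by [f] itself. *)
Lemma prox_step (T : Type) (f : 'rV[R]_n -> T -> R) (C : T -> R) (alpha : R)
    (s : T) (x g z y : 'rV[R]_n) :
  0 < alpha -> eff_dom phi y -> subdiff (f^~ s) x g -> C s <= f y s ->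
  is_argmin (prox_model f C phi alpha s x g) z ->
  eff_dom phi z /\
  f x s + dot g (z - x) + fine (phi z) + enorm (z - x) ^+ 2 / (2 * alpha)
    + (lambda + alpha^-1) / 2 * enorm (z - y) ^+ 2
  <= f y s + fine (phi y) + enorm (x - y) ^+ 2 / (2 * alpha).
Proof.
move=> a0 yD gx Cy zmin.
pose m v := Num.max (f x s + dot g (v - x)) (C s).
have zD : eff_dom phi z.
  have := zmin y; rewrite /prox_model (eff_dom_fineK yD) -!EFinD => h.
  rewrite /eff_dom/= ltey; apply/eqP => zoo; move: h.
  by rewrite zoo/= leNgt ltry.
split=> //.
have {}zmin v : eff_dom phi v ->
    m z + fine (phi z) + enorm (z - x) ^+ 2 / (2 * alpha)
    <= m v + fine (phi v) + enorm (v - x) ^+ 2 / (2 * alpha).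
  move=> vD; have := zmin v; rewrite /prox_model (eff_dom_fineK vD).
  by rewrite (eff_dom_fineK zD) -!EFinD lee_fin.
have mz : f x s + dot g (z - x) <= m z by rewrite le_max lexx.
have my : m y <= f y s by rewrite ge_max gx Cy.
have h : 0 <= (m y + fine (phi y) + enorm (y - x) ^+ 2 / (2 * alpha))
    - (m z + fine (phi z) + enorm (z - x) ^+ 2 / (2 * alpha))
    - (lambda + alpha^-1) / 2 * enorm (y - z) ^+ 2.
  apply: (@ge0_of_affine _ _ ((lambda + alpha^-1) / 2 * enorm (y - z) ^+ 2)).
  move=> t t01; have t0 : 0 < t by case/andP: t01.
  have t01' : 0 <= t <= 1 by case/andP: t01 => *; rewrite !ltW.
  have t1 : 0 <= 1 - t by rewrite subr_ge0; case/andP: t01'.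
  have [vD hv] := strongly_convex_fine yD zD t01'.
  have := zmin _ vD.
  have mv : m (t *: y + (1 - t) *: z) <= t * m y + (1 - t) * m z.
    have l1 : f x s + dot g (y - x) <= m y by rewrite le_max lexx.
    have l2 : C s <= m y by rewrite le_max lexx orbT.
    have l3 : C s <= m z by rewrite le_max lexx orbT.
    rewrite [leLHS]/m ge_max; apply/andP; split; last by nra.
    rewrite convex_comb_sub dotDr dotZr.
    have -> : dot g (y - z) = dot g (y - x) - dot g (z - x).
      by rewrite !dotE; ring.
    nra.
  have -> : enorm (t *: y + (1 - t) *: z - x) ^+ 2 =
      t * enorm (y - x) ^+ 2 + (1 - t) * enorm (z - x) ^+ 2
      - t * (1 - t) * enorm (y - z) ^+ 2.
    have -> : t *: y + (1 - t) *: z - x = t *: (y - x) + (1 - t) *: (z - x).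
      by apply/rowP => i; rewrite !mxE; ring.
    have -> : y - z = (y - x) - (z - x) by rewrite opprB addrA subrK.
    rewrite !sqr_enorm !dotE.
    by rewrite (dotC x y) (dotC z y) (dotC x z); ring.
  rewrite !invfM; move: hv mv.
  set F := fine (phi (_ + _)); set M := m (_ + _).
  set d := enorm (y - z) ^+ 2; set d1 := enorm (y - x) ^+ 2.
  set d2 := enorm (z - x) ^+ 2; set p1 := fine (phi y); set p2 := fine (phi z).
  set b := alpha^-1 => hv mv h; rewrite -(pmulr_rge0 _ t0); lra.
by move: h; rewrite (sqr_enormC x y) (sqr_enormC z y); lra.
Qed.

End StronglyConvex.

Section Jensen.
Context {R : realType} {n : nat}.

Definition convex_on (D : set 'rV[R]_n) (h : 'rV[R]_n -> R) : Prop :=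
  forall x y t, D x -> D y -> 0 <= t <= 1 ->
    D (t *: x + (1 - t) *: y) /\
    h (t *: x + (1 - t) *: y) <= t * h x + (1 - t) * h y.

Lemma jensen_sum D h (w : nat -> R) (x : nat -> 'rV[R]_n) (K : nat) :
  convex_on D h -> (forall k, 0 < w k) -> (0 < K)%N ->
  (forall k, (1 <= k <= K)%N -> D (x k)) ->
  let W := \sum_(1 <= k < K.+1) w k in
  let v := W^-1 *: \sum_(1 <= k < K.+1) w k *: x k in
  0 < W /\ D v /\ W * h v <= \sum_(1 <= k < K.+1) w k * h (x k).
Proof.
move=> hc w0; case: K => // K _; elim: K => [|K IH] xD.
  rewrite /= !big_nat1 scalerA mulVf ?lt0r_neq0// scale1r.
  by split=> //; split=> //; apply: xD.
have xD' k : (1 <= k <= K.+1)%N -> D (x k).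
  by case/andP => k1 kK; apply: xD; rewrite k1 ltnW.
have /= [W0 [vD hv]] := IH xD'.
rewrite /= !(@big_nat_recr _ _ _ K.+2)//=.
move: W0 vD hv.
set W := \sum_(1 <= k < K.+2) w k; set Y := \sum_(1 <= k < K.+2) w k *: x k.
move=> W0 vD hv; have wK := w0 K.+2.
have W1 : 0 < W + w K.+2 by rewrite addr_gt0.
split=> //; pose t := W / (W + w K.+2).
have t01 : 0 <= t <= 1.
  apply/andP; split; first by rewrite divr_ge0 // ltW.
  by rewrite /t ler_pdivrMr// mul1r lerDl ltW.
have xKD : D (x K.+2) by apply: xD; rewrite /= ltnSn.
have [zD hz] := hc _ _ _ vD xKD t01.
have E : t *: (W^-1 *: Y) + (1 - t) *: x K.+2
    = (W + w K.+2)^-1 *: (Y + w K.+2 *: x K.+2).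
  rewrite scalerDr !scalerA; congr (_ *: _ + _ *: _); rewrite /t.
    by field; rewrite !lt0r_neq0.
  by field; rewrite !lt0r_neq0.
rewrite -E; split=> //; apply: le_trans (ler_wpM2l (ltW W1) hz) _.
apply: le_trans _ (lerD hv (lexx _)); rewrite le_eqVlt; apply/orP; left.
by apply/eqP; rewrite /t; field; rewrite !lt0r_neq0.
Qed.

End Jensen.

(** * Measurability of vector-valued random variables *)

Section Borel.
Context {R : realType} {n : nat}.
Local Notation V := 'rV[R]_n.

(** Continuity on an open set that contains all values of [X] is enough, because
    the preimage of an open interval is then open within that set. *)
Lemma measurable_continuous_comp d (T : measurableType d)
    (X : T -> borelRn R n) (U : set V) (h : V -> R) :
  measurable_fun setT X -> open U -> (forall w, U (X w)) ->
  (forall y, U y -> {for y, continuous h}) ->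
  measurable_fun setT (h \o X).
Proof.
move=> mX oU XU hU; apply: (measurability _ (RGenOpens.measurableE R)).
move=> _ [_ [a [b ->]] <-]; rewrite setTI.
pose B : set V := U `&` h @^-1` `]a, b[%classic.
have oB : open B.
  rewrite openE => y [Uy hy]; apply: filterI.
    by apply: open_nbhs_nbhs.
  by apply: (hU y Uy); exact: open_nbhs_nbhs.
have -> : (h \o X) @^-1` `]a, b[%classic = X @^-1` (B : set (borelRn R n)).
  by apply/seteqP; split => w /=; [move=> ?; split|case].
rewrite -[X in measurable X]setTI; apply: mX => //.
exact: sub_sigma_algebra.
Qed.

Lemma measurable_coord d (T : measurableType d) (X : T -> borelRn R n) (i : 'I_n) :
  measurable_fun setT X -> measurable_fun setT (fun w => (X w : V) 0 i).
Proof.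
move=> mX.
apply: (@measurable_continuous_comp _ _ X setT (fun v : V => v 0 i)) => //.
  exact: openT.
have ci : continuous (fun u : V => u 0 i) by exact: coord_continuous.
by move=> y _; exact: ci.
Qed.

Lemma measurable_dot d (T : measurableType d) (X Y : T -> V) :
  (forall i, measurable_fun setT (fun w => X w 0 i)) ->
  (forall i, measurable_fun setT (fun w => Y w 0 i)) ->
  measurable_fun setT (fun w => dot (X w) (Y w)).
Proof.
by move=> mX mY; apply: measurable_sum => i; exact: measurable_funM.
Qed.

(** Functions that are continuous in the point and measurable in the parameter
    are jointly measurable: they are the limit of their values at the corner of
    the cell of mesh [1/(m+1)] that contains the point. *)
Lemma caratheodory_measurable d (S : measurableType d) (F : V -> S -> R) :
  (forall y, measurable_fun setT (F y)) ->
  (forall s, continuous (F^~ s)) ->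
  measurable_fun setT (fun p : borelRn R n * S => F (p.1 : V) p.2).
Proof.
move=> mF cF.
pose cell m (q : 'rV[int]_n) : set (borelRn R n) :=
  [set y | forall i, (q 0 i)%:~R <= m.+1%:R * (y : V) 0 i < (q 0 i + 1)%:~R].
pose rd m (y : V) : 'rV[int]_n := \row_i Num.floor (m.+1%:R * y 0 i).
pose corner m (q : 'rV[int]_n) : V := \row_i ((q 0 i)%:~R / m.+1%:R).
have cellP m q (y : V) : cell m q y <-> rd m y = q.
  split=> [h|<- i]; last by rewrite mxE floor_itv.
  by apply/rowP => i; rewrite mxE; apply: floor_def; exact: h.
have mcell m q : measurable (cell m q).
  have -> : cell m q = \bigcap_(i in [set: 'I_n])
      ((fun y : borelRn R n => m.+1%:R * (y : V) 0 i) @^-1`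
         `[(q 0 i)%:~R, (q 0 i + 1)%:~R[%classic).
    apply/seteqP; split => y h i; first by move=> _; rewrite /= in_itv/= h.
    by have := h i I; rewrite /= in_itv.
  apply: fin_bigcap_measurable => // i _.
  rewrite -[X in measurable X]setTI.
  have : measurable_fun setT (fun y : borelRn R n => m.+1%:R * (y : V) 0 i).
    by apply: measurable_funM => //; exact: measurable_coord.
  exact.
pose G m (p : borelRn R n * S) := F (corner m (rd m p.1)) p.2.
apply: (@measurable_fun_cvg _ _ _ _ G).
  move=> m _ B mB; rewrite setTI.
  have -> : G m @^-1` B =
      \bigcup_(q : 'rV[int]_n) (cell m q `*` (F (corner m q) @^-1` B)).
    apply/seteqP; split => [[y s]/= h|[y s] [q _ [/= /cellP yq h]]].
      by exists (rd m y) => //; split => //=; exact/cellP.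
    by rewrite /G/= yq.
  apply: countable_bigcupT_measurable => [|q]; first exact: countableP.
  apply: measurableX => //.
  by rewrite -[X in measurable X]setTI; apply: mF.
move=> [y s] _; rewrite /G/=.
apply/cvgrPdist_le => e e0.
have /cvgrPdist_le/(_ e e0)/nbhs_normP[r/= r0 hr] := cF s y.
near=> m; apply: hr => /=.
have mr : m.+1%:R^-1 < r by near: m; exact: (near_infty_natSinv_lt (PosNum r0)).
apply: le_lt_trans mr.
rewrite [leLHS]/Num.norm/= mx_normrE; apply/bigmax_leP; split => // -[i j] _/=.
rewrite ord1 !mxE; have /andP[h1 h2] := floor_itv (m.+1%:R * (y : V) 0 j).
have m0 : (0 : R) < m.+1%:R by [].
have -> : (y : V) 0 j - (Num.floor (m.+1%:R * (y : V) 0 j))%:~R / m.+1%:R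
  = (m.+1%:R * (y : V) 0 j - (Num.floor (m.+1%:R * (y : V) 0 j))%:~R) / m.+1%:R.
  by field; rewrite lt0r_neq0.
rewrite ger0_norm; last by rewrite divr_ge0 ?subr_ge0 // ltW.
rewrite -[leRHS]mul1r ler_wpM2r//.
by rewrite lerBlDl ltW//; move: h2; rewrite intrD.
Unshelve. all: by end_near. Qed.

End Borel.

(** * Integrals of real functions *)

Section Integrals.
Context d (T : measurableType d) (R : realType) (mu : {measure set T -> \bar R}).
Implicit Types X Y : T -> R.

Lemma integrable_dominated X Y : measurable_fun setT X ->
  (forall w, `|X w| <= Y w) -> mu.-integrable setT (EFin \o Y) ->
  mu.-integrable setT (EFin \o X).
Proof.
move=> mX XY; apply: le_integrable => //; first exact/measurable_EFinP.
by move=> w _; rewrite /= lee_fin (le_trans (XY w))// ler_norm.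
Qed.

Lemma integrableDr X Y : mu.-integrable setT (EFin \o X) ->
  mu.-integrable setT (EFin \o Y) ->
  mu.-integrable setT (EFin \o (fun w => X w + Y w)).
Proof. by move=> iX iY; have := integrableD measurableT iX iY. Qed.

Lemma integrableBr X Y : mu.-integrable setT (EFin \o X) ->
  mu.-integrable setT (EFin \o Y) ->
  mu.-integrable setT (EFin \o (fun w => X w - Y w)).
Proof. by move=> iX iY; have := integrableB measurableT iX iY. Qed.

Lemma integrableZr (k : R) X : mu.-integrable setT (EFin \o X) ->
  mu.-integrable setT (EFin \o (fun w => k * X w)).
Proof. by move=> iX; have := integrableZl measurableT k iX. Qed.

Lemma Rintegral_young X Y Z (t : R) : mu.-integrable setT (EFin \o X) ->
  mu.-integrable setT (EFin \o Y) -> mu.-integrable setT (EFin \o Z) ->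
  (forall w, X w <= Y w / (4 * t) + t * Z w) ->
  \int[mu]_w X w <= \int[mu]_w Y w / (4 * t) + t * \int[mu]_w Z w.
Proof.
move=> iX iY iZ h.
have iY' : mu.-integrable setT (EFin \o (fun w => (4 * t)^-1 * Y w)).
  exact: integrableZr.
have iZ' : mu.-integrable setT (EFin \o (fun w => t * Z w)) by exact: integrableZr.
have eY := RintegralZl (4 * t)^-1 measurableT iY.
rewrite mulrC -eY -(RintegralZl t measurableT iZ) -RintegralD//.
apply: le_Rintegral => //; first exact: integrableDr.
by move=> w _; rewrite (mulrC _^-1); exact: h.
Qed.

Lemma Rintegral_lincomb (a : nat -> R) (Z : nat -> T -> R) (K : nat) :
  (forall k, (k < K)%N -> mu.-integrable setT (EFin \o Z k)) ->
  let Y w := \sum_(0 <= k < K) a k * Z k w in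
  mu.-integrable setT (EFin \o Y) /\
  \int[mu]_w Y w = \sum_(0 <= k < K) a k * \int[mu]_w Z k w.
Proof.
elim: K => [|K IH] iZ /=.
  have E : (fun w => \sum_(0 <= k < 0) a k * Z k w) = (fun=> 0).
    by apply/funext => w; rewrite big_geq.
  rewrite E big_geq//; split; first exact: integrable0.
  by rewrite /Rintegral integral0.
have [iY EY] := IH (fun k kK => iZ k (ltnW kK)).
have iK := integrableZr (a K) (iZ K (ltnSn K)).
have E : (fun w => \sum_(0 <= k < K.+1) a k * Z k w) =
    (fun w => \sum_(0 <= k < K) a k * Z k w + a K * Z K w).
  by apply/funext => w; rewrite big_nat_recr.
rewrite E; split; first exact: integrableDr.
rewrite RintegralD// EY big_nat_recr//=; congr (_ + _).
by rewrite RintegralZl//; exact: iZ.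
Qed.

(** The integral of a nonnegative function is the supremum over the simple
    functions below it, so monotonicity is immediate for an arbitrary [f].  It
    is applied to a function that involves [phi]. *)
Lemma ge0_integral_le (f : T -> \bar R) X : (forall w, 0 <= f w)%E ->
  (forall w, f w <= (X w)%:E)%E -> mu.-integrable setT (EFin \o X) ->
  (\int[mu]_w f w <= (\int[mu]_w X w)%R%:E)%E.
Proof.
move=> f0 fX iX; rewrite fineK; last exact: integrable_fin_num.
have X0 w : (0 <= (X w)%:E)%E := le_trans (f0 w) (fX w).
rewrite ge0_integralTE// [leRHS]ge0_integralTE//.
apply: le_ereal_sup => _ [/= h hf <-]; exists h => // w.
exact: le_trans (hf w) (fX w).
Qed.

End Integrals.

Lemma Rintegral_prob_cst d (T : measurableType d) (R : realType)
  (P : probability T R) (r : R) : \int[P]_w r = r.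
Proof.
rewrite Rintegral_cst// -[RHS]mulr1; congr (_ * _).
exact: (congr1 fine (probability_setT P)).
Qed.

(** * Integrating out an independent variable *)

Section Independence.
Context dO d1 d2 (Omega : measurableType dO) (T1 : measurableType d1)
  (T2 : measurableType d2) (R : realType).
Variables (Pr : probability Omega R) (P : probability T2 R).
Variables (X : {RV Pr >-> T1}) (Y : {RV Pr >-> T2}).
Hypothesis Y_law : forall A, measurable A -> distribution Pr Y A = P A.
Hypothesis XY_indep : forall A B, measurable A -> measurable B ->
  Pr (X @^-1` A `&` Y @^-1` B) = (Pr (X @^-1` A) * Pr (Y @^-1` B))%E.

Lemma law_ge0_integral (f : T2 -> \bar R) : measurable_fun setT f ->
  (forall y, 0 <= f y)%E -> (\int[Pr]_w f (Y w) = \int[P]_y f y)%E.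
Proof.
move=> mf f0; rewrite -[LHS](@ge0_integral_distribution _ _ _ _ _ Pr Y f)//.
by apply: eq_measure_integral => A mA _; exact: Y_law.
Qed.

Let Z w := (X w, Y w).

Let mZ : measurable_fun setT Z. Proof. exact: measurable_fun_pair. Qed.

HB.instance Definition _ := isMeasurableFun.Build _ _ _ _ Z mZ.

Lemma joint_law A : measurable A ->
  (distribution Pr X \x P)%E A = distribution Pr (Z : {mfun Omega >-> (T1 * T2)%type}) A.
Proof.
apply: product_measure_unique => B C mB mC.
transitivity (Pr (X @^-1` B) * Pr (Y @^-1` C))%E; first exact: XY_indep.
by congr (_ * _)%E; exact: Y_law.
Qed.

Variable F : T1 * T2 -> R.
Hypothesis mF : measurable_fun setT F.
Hypothesis iF : Pr.-integrable setT (EFin \o (fun w => F (X w, Y w))).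

Let iFprod : (distribution Pr X \x P)%E.-integrable setT (EFin \o F).
Proof.
have mFE : measurable_fun setT (EFin \o F) by exact/measurable_EFinP.
have := integrable_pushforward mZ mFE iF measurableT.
move=> /integrableP[_ h]; apply/integrableP; split => //.
apply: le_lt_trans h; rewrite le_eqVlt; apply/orP; left; apply/eqP.
by apply: eq_measure_integral => A mA _; exact: joint_law.
Qed.

(** A variable whose joint law with the past is a product can be integrated out
    with the past held fixed. *)
Lemma indep_integral :
  (\int[Pr]_w (F (X w, Y w))%:E = \int[Pr]_w \int[P]_s (F (X w, s))%:E)%E.
Proof.
have mFE : measurable_fun setT (EFin \o F) by exact/measurable_EFinP.
have <- := integral_pushforward mZ mFE iF measurableT.
transitivity (\int[distribution Pr X \x P]_z (EFin \o F) z)%E.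
  by apply: eq_measure_integral => A mA _; apply/esym; exact: joint_law.
rewrite -(integral12_prod_meas1 iFprod).
have iG := integrable_fubini_F iFprod.
have mG := measurable_int _ iG.
have iGX : Pr.-integrable setT (fubini_F P (EFin \o F) \o X).
  move/integrableP : iG => [_ h]; apply/integrableP; split.
    exact: measurableT_comp.
  apply: le_lt_trans h; rewrite le_eqVlt; apply/orP; left; apply/eqP.
  rewrite [RHS](ge0_integral_pushforward (measurable_funP X))//.
  exact: measurableT_comp.
by rewrite [LHS](integral_pushforward (measurable_funP X) mG).
Qed.

End Independence.

(** * The stochastic objective *)

Section Convergence.
Context (R : realType) (n : nat) (dS : measure_display) (S : measurableType dS)
  (P : probability S R).
Variables (f : 'rV[R]_n -> S -> R) (phi : 'rV[R]_n -> \bar R) (lambda : R)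
  (U : set 'rV[R]_n) (G : S -> R) (xstar : 'rV[R]_n).
Hypothesis f_lip : forall s, locally_lipschitz (f^~ s).
Hypothesis f_convex : forall s,
  convex_function [set: convex_lmodType 'rV[R]_n] (f^~ s).
Hypothesis f_int : forall y, P.-integrable setT (EFin \o f y).
Hypothesis f_inf : forall s, has_inf (range (f^~ s)).
Hypothesis phi_proper : proper_fun phi.
Hypothesis phi_convex : strongly_convex lambda phi.
Hypothesis lambda_gt0 : 0 < lambda.
Hypothesis U_open : open U.
Hypothesis dom_U : eff_dom phi `<=` U.
Hypothesis G_ge0 : forall s, 0 <= G s.
Hypothesis G_meas : measurable_fun setT G.
Hypothesis G_L2 : ('E_P[(fun s => G s ^+ 2)%R] < +oo)%E.
Hypothesis G_bound : forall s y h, U y -> subdiff (f^~ s) y h -> enorm h <= G s.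
Hypothesis xstarP : is_argmin (objective P f phi) xstar.

Definition mean_f (y : 'rV[R]_n) : R := \int[P]_s f y s.
Definition sqr_bound : R := \int[P]_s (G s ^+ 2).
Local Notation V2 := sqr_bound.

Lemma sqr_boundE : fine ('E_P[(fun s => G s ^+ 2)%R])%E = V2.
Proof. by rewrite unlock. Qed.

Lemma sqr_bound_ge0 : 0 <= V2.
Proof. by apply: Rintegral_ge0 => s _; exact: sqr_ge0. Qed.

Lemma G2_integrable : P.-integrable setT (EFin \o (fun s => G s ^+ 2)).
Proof.
apply/integrableP; split.
  by apply/measurable_EFinP; exact: measurable_funX.
apply: le_lt_trans G_L2; rewrite unlock le_eqVlt; apply/orP; left; apply/eqP.
by apply: eq_integral => s _; rewrite /= ger0_norm ?sqr_ge0.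
Qed.

Lemma sample_lipschitz s y z t : U y -> 0 < t ->
  f y s - f z s <= G s ^+ 2 / (4 * t) + t * enorm (y - z) ^+ 2.
Proof.
move=> Uy t0.
apply: (@subgradient_bound _ _ (f^~ s) U (G s) (inf (range (f^~ s)))) => //.
- exact: convex_functionP.
- exact: locally_lipschitz_continuous.
- by move=> v; apply: ge_inf; [exact: (f_inf s).2|exists v].
- by move=> u g; exact: G_bound.
Qed.

Lemma mean_fB_integrable y z :
  P.-integrable setT (EFin \o (fun s => f y s - f z s)).
Proof. exact: (integrableBr (f_int y) (f_int z)). Qed.

Lemma mean_fB y z : mean_f y - mean_f z = \int[P]_s (f y s - f z s).
Proof. by rewrite RintegralB. Qed.

Lemma mean_lipschitz y z t : U y -> 0 < t ->
  mean_f y - mean_f z <= V2 / (4 * t) + t * enorm (y - z) ^+ 2.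
Proof.
move=> Uy t0; rewrite mean_fB.
have -> : enorm (y - z) ^+ 2 = \int[P]_s (enorm (y - z) ^+ 2).
  by rewrite Rintegral_prob_cst.
apply: (@Rintegral_young _ _ _ P _ (fun s => G s ^+ 2) (fun=> enorm (y - z) ^+ 2)).
- exact: mean_fB_integrable.
- exact: G2_integrable.
- exact: finite_measure_integrable_cst.
- by move=> s; exact: sample_lipschitz.
Qed.

(** For a prescribed error, a large [t] makes the constant term of
    [mean_lipschitz] small, and then the quadratic term is small near [y]. *)
Lemma mean_f_continuous y : U y -> {for y, continuous mean_f}.
Proof.
move=> Uy; apply/(@cvgrPdist_le _ _ _ (nbhs y)) => e e0.
pose t := V2 / (2 * e) + 1.
have t0 : 0 < t by rewrite ltr_wpDl// divr_ge0 ?sqr_bound_ge0// mulr_ge0// ltW.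
have Vt : V2 / (4 * t) <= e / 2.
  rewrite ler_pdivrMr ?mulr_gt0// /t mulrDr.
  have -> : e / 2 * (4 * (V2 / (2 * e)) + 4 * 1) = V2 + 2 * e.
    by field; rewrite lt0r_neq0.
  by rewrite lerDl mulr_ge0// ltW.
have cont := continuousM (@cst_continuous _ _ t y) (@sqr_enormB_continuous _ _ y y).
have e2 : 0 < e / 2 by rewrite divr_gt0.
have /(@cvgrPdist_le _ _ _ (nbhs y))/(_ _ e2) near_t := cont.
near=> v.
have Uv : U v by near: v; exact: open_nbhs_nbhs.
have tv : t * enorm (v - y) ^+ 2 <= e / 2.
  have : `|t * enorm (y - y) ^+ 2 - t * enorm (v - y) ^+ 2| <= e / 2.
    by near: v; exact: near_t.
  rewrite subrr enorm0 expr0n mulr0 sub0r normrN ger0_norm//.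
  by rewrite mulr_ge0 ?sqr_ge0// ltW.
have h1 := mean_lipschitz v Uy t0.
have h2 := mean_lipschitz y Uv t0.
rewrite sqr_enormC in h1.
rewrite ler_norml; apply/andP; split; lra.
Unshelve. all: by end_near. Qed.

Lemma objectiveE y : eff_dom phi y ->
  objective P f phi y = (mean_f y + fine (phi y))%:E.
Proof.
move=> yD; rewrite /objective (eff_dom_fineK phi_proper yD) EFinD.
congr (_ + _)%E; rewrite unlock /mean_f /Rintegral fineK//.
exact: integrable_fin_num (f_int y).
Qed.

Lemma xstar_dom : eff_dom phi xstar.
Proof.
have [y yD] := phi_proper.2.
have := xstarP y; rewrite (objectiveE yD) /objective => h.
rewrite /eff_dom/= ltey; apply/eqP => xoo; move: h; rewrite xoo.
rewrite unlock -[X in (X + _)%E](fineK (integrable_fin_num measurableT (f_int xstar))).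
by rewrite leNgt/= ltry.
Qed.

Lemma xstar_U : U xstar. Proof. exact: dom_U xstar_dom. Qed.

Lemma objective_min y : eff_dom phi y ->
  mean_f xstar + fine (phi xstar) <= mean_f y + fine (phi y).
Proof.
by move=> yD; have := xstarP y; rewrite !objectiveE ?lee_fin//; exact: xstar_dom.
Qed.

Lemma objective_convex :
  convex_on (eff_dom phi) (fun y => mean_f y + fine (phi y)).
Proof.
move=> y z t yD zD t01.
have [vD hv] := strongly_convex_fine phi_proper phi_convex yD zD t01.
split=> //.
have hf : mean_f (t *: y + (1 - t) *: z) <= t * mean_f y + (1 - t) * mean_f z.
  rewrite /mean_f -!RintegralZl// -RintegralD//; try exact: integrableZr.
  apply: le_Rintegral => //.
    by apply: integrableDr; exact: integrableZr.
  by move=> s _; exact: (convex_functionP (@f_convex s) y z t01).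
have d0 : 0 <= lambda / 2 * t * (1 - t) * enorm (y - z) ^+ 2.
  case/andP: t01 => t0 t1; rewrite mulr_ge0 ?sqr_ge0// mulr_ge0 ?subr_ge0//.
  by rewrite mulr_ge0// divr_ge0// ltW.
lra.
Qed.


(** * The iterates *)

Context (dO : measure_display) (Omega : measurableType dO)
  (Pr : probability Omega R).
Variables (C : S -> R) (x0 : 'rV[R]_n) (K : nat) (xi : nat -> {RV Pr >-> S})
  (x g : nat -> {RV Pr >-> borelRn R n}).
Hypothesis C_le : forall s, C s <= inf (range (f^~ s)).
Hypothesis x0_U : U x0.
Hypothesis xP :
  ProxSPS P f C phi (fun k => 2 / (lambda * (k%:R + 1))) x0 K xi x g.

Local Notation pt k w := (x k w : 'rV[R]_n).
Local Notation sg k w := (g k w : 'rV[R]_n).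
Local Notation sqd i j w := (enorm (pt i w - pt j w) ^+ 2).
Local Notation dst k w := (enorm (pt k w - xstar) ^+ 2).
Local Notation integ X := (Pr.-integrable setT (EFin \o X)).

Lemma C_le_f s y : C s <= f y s.
Proof. by apply: le_trans (C_le s) _; apply: ge_inf; [exact: (f_inf s).2|exists y]. Qed.

Lemma iterate_step k w : (k < K)%N ->
  eff_dom phi (pt k.+1 w) /\
  f (pt k w) (xi k w) + dot (sg k w) (pt k.+1 w - pt k w) + fine (phi (pt k.+1 w))
    + lambda * (k%:R + 1) / 4 * sqd k.+1 k w
    + lambda * (k%:R + 3) / 4 * dst k.+1 w
  <= f xstar (xi k w) + fine (phi xstar) + lambda * (k%:R + 1) / 4 * dst k w.
Proof.
move=> kK; have k1 : (0 : R) < k%:R + 1 by rewrite ltr_wpDl.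
have a0 : 0 < 2 / (lambda * (k%:R + 1)) by rewrite divr_gt0// mulr_gt0.
have [zD h] := prox_step phi_proper phi_convex a0 xstar_dom
  (proxsps_subgrad xP kK w) (C_le_f _ _) (proxsps_update xP kK w).
split=> //; move: h.
have -> : (2 / (lambda * (k%:R + 1)))^-1 = lambda * (k%:R + 1) / 2.
  by field; rewrite !lt0r_neq0.
have E (a : R) : a / (2 * (2 / (lambda * (k%:R + 1)))) = lambda * (k%:R + 1) / 4 * a.
  by field; rewrite !lt0r_neq0.
rewrite !E => h; lra.
Qed.

Lemma iterate_U k w : (k <= K)%N -> U (pt k w).
Proof.
case: k => [_|k kK]; first by rewrite (proxsps_init xP).
by apply: dom_U; have [] := iterate_step w kK.
Qed.

Lemma measurable_pt k i : measurable_fun setT (fun w => pt k w 0 i).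
Proof. exact/measurable_coord/measurable_funP. Qed.

Lemma measurable_ptB i j l :
  measurable_fun setT (fun w => (pt i w - pt j w) 0 l).
Proof.
have -> : (fun w => (pt i w - pt j w) 0 l) = (fun w => pt i w 0 l - pt j w 0 l).
  by apply/funext => w; rewrite !mxE.
by apply: measurable_funB; exact: measurable_pt.
Qed.

Lemma measurable_dst k : measurable_fun setT (fun w => dst k w).
Proof.
have -> : (fun w => dst k w) = (fun w => dot (pt k w - xstar) (pt k w - xstar)).
  by apply/funext => w; rewrite sqr_enorm.
have h i : measurable_fun setT (fun w => (pt k w - xstar) 0 i).
  have -> : (fun w => (pt k w - xstar) 0 i) = (fun w => pt k w 0 i - xstar 0 i).
    by apply/funext => w; rewrite !mxE.
  by apply: measurable_funB => //; exact: measurable_pt.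
exact: measurable_dot.
Qed.

Lemma measurable_sqd i j : measurable_fun setT (fun w => sqd i j w).
Proof.
have -> : (fun w => sqd i j w) = (fun w => dot (pt i w - pt j w) (pt i w - pt j w)).
  by apply/funext => w; rewrite sqr_enorm.
by apply: measurable_dot => l; exact: measurable_ptB.
Qed.

Lemma measurable_inner k i j :
  measurable_fun setT (fun w => dot (sg k w) (pt i w - pt j w)).
Proof.
apply: measurable_dot => l; last exact: measurable_ptB.
exact/measurable_coord/measurable_funP.
Qed.

Lemma measurable_mean k : (k <= K)%N ->
  measurable_fun setT (fun w => mean_f (pt k w)).
Proof.
move=> kK; apply: (@measurable_continuous_comp _ _ _ _ (x k) U mean_f) => //.
- by move=> w; exact: iterate_U.
- by move=> y; exact: mean_f_continuous.
Qed.

Lemma measurable_f2 : measurable_fun setT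
  (fun p : borelRn R n * S => f (p.1 : 'rV[R]_n) p.2 - f xstar p.2).
Proof.
have mf y : measurable_fun setT (f y).
  by apply/measurable_EFinP; exact: measurable_int (f_int y).
apply: measurable_funB; last exact: (measurableT_comp (mf xstar)).
apply: caratheodory_measurable => // s.
exact: locally_lipschitz_continuous.
Qed.

Lemma sqd_le i j w : sqd i j w <= 2 * (dst i w + dst j w).
Proof.
rewrite -parallelogram.
have -> : pt i w - xstar - (pt j w - xstar) = pt i w - pt j w.
  by rewrite opprB addrA subrK.
by rewrite lerDl sqr_ge0.
Qed.

Lemma sample_G2 k : (k < K)%N ->
  integ (fun w => G (xi k w) ^+ 2) /\ \int[Pr]_w (G (xi k w) ^+ 2) = V2.
Proof.
move=> kK; have mG2 : measurable_fun setT (fun s => (G s ^+ 2)%:E).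
  by apply/measurable_EFinP; exact: measurable_funX.
have E : (\int[Pr]_w (G (xi k w) ^+ 2)%:E = \int[P]_s (G s ^+ 2)%:E)%E.
  apply: (law_ge0_integral (proxsps_law xP kK) mG2) => s.
  by rewrite lee_fin sqr_ge0.
split; last by rewrite /Rintegral E.
have /integrableP[_ h] := G2_integrable.
apply/integrableP; split; first exact: (measurableT_comp mG2).
apply: le_lt_trans h; rewrite le_eqVlt; apply/orP; left; apply/eqP.
transitivity (\int[Pr]_w (G (xi k w) ^+ 2)%:E)%E.
  by apply: eq_integral => w _; rewrite /= ger0_norm ?sqr_ge0.
by rewrite E; apply: eq_integral => s _; rewrite /= ger0_norm ?sqr_ge0.
Qed.

Lemma subgradient_le k w : (k < K)%N -> enorm (sg k w) <= G (xi k w).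
Proof.
move=> kK; apply: (@G_bound _ (pt k w)); first exact: iterate_U (ltnW kK).
exact: (proxsps_subgrad xP kK w).
Qed.

Lemma inner_young k w t (v : 'rV[R]_n) : (k < K)%N -> 0 < t ->
  dot (sg k w) v <= G (xi k w) ^+ 2 / (4 * t) + t * enorm v ^+ 2.
Proof.
move=> kK t0; apply: le_trans (dot_young _ _ t0) _.
rewrite lerD2r ler_pM2r ?invr_gt0 ?mulr_gt0//.
by rewrite ler_sqr ?nnegrE ?enorm_ge0// subgradient_le.
Qed.

(** The second moments stay finite: the drop of [phi] in a step is controlled
    by the optimality of [xstar] and the Lipschitz bound on [mean_f]. *)
Lemma integrable_dst k : (k <= K)%N -> integ (fun w => dst k w).
Proof.
elim: k => [_|k IH kK].
  have -> : (fun w => dst 0 w) = cst (enorm (x0 - xstar) ^+ 2).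
    by apply/funext => w /=; rewrite (proxsps_init xP).
  exact: finite_measure_integrable_cst.
(* The bound [B] is what [iterate_step] leaves when the ascent of the sample
   function, the inner product and the drop of [phi] are estimated with the
   weights [1], [c1] and [c0]; [c1] cancels the quadratic term of the step and
   [c0] uses up a part of the coefficient of the new distance. *)
have {}IH := IH (ltnW kK); have [iG _] := sample_G2 kK.
set kr : R := k%:R; have kr0 : 0 <= kr by [].
pose c1 := lambda * (kr + 1) / 4; pose c0 := lambda / 4.
have l0 := lambda_gt0.
have c10 : 0 < c1 by rewrite /c1; nra.
have c00 : 0 < c0 by rewrite /c0; lra.
pose B w := (c0^-1 * (V2 / (4 * c0))) +
  (c0^-1 * (4^-1 + (4 * c1)^-1) * (G (xi k w) ^+ 2) + c0^-1 * (1 + c1) * dst k w).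
apply: (@integrable_dominated _ _ _ _ _ B) => [||].
- exact: measurable_dst.
- move=> w; rewrite ger0_norm ?sqr_ge0//.
  have -> : B w = c0^-1 * (V2 / (4 * c0) + (4^-1 + (4 * c1)^-1) * G (xi k w) ^+ 2
      + (1 + c1) * dst k w) by rewrite /B; ring.
  rewrite -(ler_pM2l c00) [leRHS]mulVKf ?lt0r_neq0//.
  have [xD] := iterate_step w kK; rewrite -/kr.
  have := inner_young w (- (pt k.+1 w - pt k w)) kK c10.
  have := mean_lipschitz xstar (iterate_U w kK) c00.
  have := objective_min xD.
  have := sample_lipschitz (xi k w) (pt k w) xstar_U ltr01.
  rewrite (sqr_enormC xstar) mul1r mulr1 dotNr.
  have -> : enorm (- (pt k.+1 w - pt k w)) ^+ 2 = sqd k.+1 k w.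
    by rewrite opprB sqr_enormC.
  have -> : G (xi k w) ^+ 2 / (4 * c1) = (4 * c1)^-1 * G (xi k w) ^+ 2.
    by rewrite mulrC.
  set a1 := dot _ _; set a2 := (4 * c1)^-1; set a3 := V2 / _; set a4 := sqd _ _ _.
  set a5 := dst k.+1 w; set a6 := dst k w; set a7 := G _ ^+ 2.
  have a50 : 0 <= a5 by exact: sqr_ge0.
  rewrite /c1 /c0 => h1 h2 h3 h4 h5.
  have : 0 <= lambda * (kr + 1) * a5 by rewrite mulr_ge0// mulr_ge0 ?ltW// ltr_wpDl.
  lra.
- apply: integrableDr; first exact: finite_measure_integrable_cst.
  by apply: integrableDr; exact: integrableZr.
Qed.

Lemma integrable_sqd i j : (i <= K)%N -> (j <= K)%N -> integ (fun w => sqd i j w).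
Proof.
move=> iK jK.
apply: (@integrable_dominated _ _ _ _ _ (fun w => 2 * (dst i w + dst j w))).
- exact: measurable_sqd.
- by move=> w; rewrite ger0_norm ?sqr_ge0// sqd_le.
- by apply: integrableZr; apply: integrableDr; exact: integrable_dst.
Qed.

Lemma integrable_inner k i j : (k < K)%N -> (i <= K)%N -> (j <= K)%N ->
  integ (fun w => dot (sg k w) (pt i w - pt j w)).
Proof.
move=> kK iK jK; have [iG _] := sample_G2 kK.
apply: (@integrable_dominated _ _ _ _ _
  (fun w => 4^-1 * (G (xi k w) ^+ 2) + sqd i j w)).
- exact: measurable_inner.
- move=> w; have := inner_young w (pt i w - pt j w) kK ltr01.
  have := inner_young w (- (pt i w - pt j w)) kK ltr01.
  have -> : enorm (- (pt i w - pt j w)) ^+ 2 = sqd i j w by rewrite opprB sqr_enormC.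
  rewrite dotNr !mul1r !mulr1 => h1 h2; rewrite ler_norml; apply/andP; split; lra.
- by apply: integrableDr; [exact: integrableZr|exact: integrable_sqd].
Qed.

Lemma integrable_gap k : (k <= K)%N -> integ (fun w => mean_f (pt k w) - mean_f xstar).
Proof.
move=> kK; apply: (@integrable_dominated _ _ _ _ _ (fun w => V2 / 4 + dst k w)).
- by apply: measurable_funB => //; exact: measurable_mean.
- move=> w; have := mean_lipschitz xstar (iterate_U w kK) ltr01.
  have := mean_lipschitz (pt k w) xstar_U ltr01.
  rewrite (sqr_enormC xstar) !mul1r !mulr1 => h1 h2.
  by rewrite ler_norml; apply/andP; split; lra.
- by apply: integrableDr; [exact: finite_measure_integrable_cst|exact: integrable_dst].
Qed.

Lemma integrable_sample_gap i k : (i <= K)%N -> (k < K)%N ->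
  integ (fun w => f (pt i w) (xi k w) - f xstar (xi k w)).
Proof.
move=> iK kK; have [iG _] := sample_G2 kK.
apply: (@integrable_dominated _ _ _ _ _
  (fun w => 4^-1 * (G (xi k w) ^+ 2) + dst i w)).
- have m2 : measurable_fun setT (fun w => (x i w, xi k w)) by exact: measurable_fun_pair.
  exact: (measurableT_comp measurable_f2 m2).
- move=> w; have := sample_lipschitz (xi k w) xstar (iterate_U w iK) ltr01.
  have := sample_lipschitz (xi k w) (pt i w) xstar_U ltr01.
  rewrite (sqr_enormC xstar) !mul1r !mulr1 => h1 h2.
  by rewrite ler_norml; apply/andP; split; lra.
- by apply: integrableDr; [exact: integrableZr|exact: integrable_dst].
Qed.

(** The [k]-th sample is fresh for the iterates up to the [k]-th one, not only
    for the current one. *)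
Lemma sample_gap_mean i k : (i <= k)%N -> (k < K)%N ->
  \int[Pr]_w (f (pt i w) (xi k w) - f xstar (xi k w))
  = \int[Pr]_w (mean_f (pt i w) - mean_f xstar).
Proof.
move=> ik kK; have iK : (i <= K)%N := leq_trans ik (ltnW kK).
have indep A B : measurable A -> measurable B ->
    Pr (x i @^-1` A `&` xi k @^-1` B) = (Pr (x i @^-1` A) * Pr (xi k @^-1` B))%E.
  move=> mA mB; apply: (proxsps_indep xP kK mB).
  by apply: sub_sigma_algebra; left; exists i, A.
have /= E := indep_integral (proxsps_law xP kK) indep measurable_f2
  (integrable_sample_gap iK kK).
rewrite /Rintegral E; congr fine; apply: eq_integral => w _.
by rewrite mean_fB /Rintegral fineK//; apply: integrable_fin_num => //; exact: mean_fB_integrable.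
Qed.

(** * Mean noise of the iterates *)

Let e k := \int[Pr]_w (mean_f (pt k w) - mean_f xstar).
Let c k := \int[Pr]_w dot (sg k w) (pt k.+1 w - pt k w).
Let A k := \int[Pr]_w sqd k.+1 k w.
Let D k := \int[Pr]_w dst k w.

Lemma gap_le i j t : (i <= K)%N -> (j <= K)%N -> 0 < t ->
  e i - e j <= V2 / (4 * t) + t * \int[Pr]_w sqd i j w.
Proof.
move=> iK jK t0; rewrite /e -RintegralB//; try exact: integrable_gap.
rewrite -[X in X / _](Rintegral_prob_cst Pr V2).
apply: Rintegral_young.
- by apply: integrableBr; exact: integrable_gap.
- exact: finite_measure_integrable_cst.
- exact: integrable_sqd.
- by move=> w; have := mean_lipschitz (pt j w) (iterate_U w iK) t0; lra.
Qed.

Lemma inner_le k t : (k < K)%N -> 0 < t -> - c k <= V2 / (4 * t) + t * A k.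
Proof.
move=> kK t0; have [iG EG] := sample_G2 kK.
have ic := integrable_inner kK kK (ltnW kK).
rewrite -mulN1r /c -RintegralZl// -EG.
apply: Rintegral_young => //; first exact: integrableZr.
  exact: integrable_sqd kK (ltnW kK).
move=> w; have := inner_young w (- (pt k.+1 w - pt k w)) kK t0.
have -> : enorm (- (pt k.+1 w - pt k w)) ^+ 2 = sqd k.+1 k w by rewrite opprB sqr_enormC.
by rewrite dotNr mulN1r.
Qed.

(** The mean ascent of [f] over one displacement is at most its mean inner
    product with the next subgradient. *)
Lemma gap_le_next_inner k : (k.+1 < K)%N ->
  e k.+1 - e k <= \int[Pr]_w dot (sg k.+1 w) (pt k.+1 w - pt k w).
Proof.
move=> kK; have k1K := ltnW kK; have k0K := ltnW k1K.
rewrite /e -(sample_gap_mean (leqnn k.+1) kK) -(sample_gap_mean (leqnSn k) kK).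
have i1 := integrable_sample_gap k1K kK; have i0 := integrable_sample_gap k0K kK.
rewrite -RintegralB//; apply: le_Rintegral => //.
- exact: integrableBr.
- exact: integrable_inner.
- move=> w _; have := proxsps_subgrad xP kK w (pt k w).
  by rewrite -opprB dotNr; lra.
Qed.

(** With [a] and [b] the two displacements, the left side is the mean of
    [<g, a> - <g, b>], which is controlled by [|a - b|], plus the ascent between
    the end points, which is controlled by [|a + b|]; the parallelogram law adds
    the two. *)
Lemma pair_gap_le k t : (k.+1 < K)%N -> 0 < t ->
  (e k.+1 - e k) - c k.+1 + (e k.+2 - e k) <= V2 / (2 * t) + 2 * t * (A k + A k.+1).
Proof.
move=> kK t0; have k1K := ltnW kK; have k0K := ltnW k1K.
have [iG EG] := sample_G2 kK.
have i1 := integrable_inner kK k1K k0K.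
have i2 := integrable_inner kK kK k1K.
pose turn w := enorm ((pt k.+1 w - pt k w) - (pt k.+2 w - pt k.+1 w)) ^+ 2.
have turnE w : turn w = 2 * (sqd k.+1 k w + sqd k.+2 k.+1 w) - sqd k.+2 k w.
  rewrite -parallelogram /turn.
  have -> : pt k.+1 w - pt k w + (pt k.+2 w - pt k.+1 w) = pt k.+2 w - pt k w.
    by rewrite addrC addrA subrK.
  by rewrite addrK.
have is1 := integrable_sqd k1K k0K.
have is2 := integrable_sqd kK k1K.
have is3 := integrable_sqd kK k0K.
have is12 : integ (fun w => 2 * (sqd k.+1 k w + sqd k.+2 k.+1 w)).
  by apply: integrableZr; exact: integrableDr.
have iturn : integ turn.
  have -> : turn = (fun w => 2 * (sqd k.+1 k w + sqd k.+2 k.+1 w) - sqd k.+2 k w).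
    by apply/funext.
  exact: integrableBr.
have turn_mean : \int[Pr]_w turn w = 2 * (A k + A k.+1) - \int[Pr]_w sqd k.+2 k w.
  under eq_Rintegral do rewrite turnE.
  rewrite RintegralB// RintegralZl//; last exact: integrableDr.
  by rewrite RintegralD.
have h1 : \int[Pr]_w dot (sg k.+1 w) (pt k.+1 w - pt k w) - c k.+1
    <= V2 / (4 * t) + t * \int[Pr]_w turn w.
  rewrite /c -RintegralB// -EG; apply: Rintegral_young => //.
    exact: integrableBr.
  move=> w; rewrite -dotNr -dotDr; exact: inner_young.
have h2 := gap_le_next_inner kK.
have h3 := gap_le kK k0K t0.
have -> : V2 / (2 * t) = V2 / (4 * t) + V2 / (4 * t) by field; rewrite lt0r_neq0.
rewrite turn_mean in h1; move: h1 h2 h3.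
move: (c k.+1) (e k) (e k.+1) (e k.+2) (V2 / (4 * t)) (A k) (A k.+1).
move: (\int[Pr]_w dot _ _) (\int[Pr]_w sqd k.+2 k w).
by move=> b1 b2 b3 b4 b5 b6 b7 b8 b9 h1 h2 h3; lra.
Qed.

(** The pathwise bound on the gap at the next iterate, with the values of [phi]
    eliminated. *)
Let H k w : R :=
  (mean_f (pt k.+1 w) - mean_f xstar) - (f (pt k w) (xi k w) - f xstar (xi k w))
  - dot (sg k w) (pt k.+1 w - pt k w) - lambda * (k%:R + 1) / 4 * sqd k.+1 k w
  + (lambda * (k%:R + 1) / 4 * dst k w - lambda * (k%:R + 3) / 4 * dst k.+1 w).

Let H_ge k w : (k < K)%N ->
  mean_f (pt k.+1 w) + fine (phi (pt k.+1 w)) - (mean_f xstar + fine (phi xstar))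
  <= H k w.
Proof. by move=> kK; have [_] := iterate_step w kK; rewrite /H; lra. Qed.

Let H_mean k : (k < K)%N -> integ (H k) /\
  \int[Pr]_w H k w = e k.+1 - e k - c k - lambda * (k%:R + 1) / 4 * A k
    + (lambda * (k%:R + 1) / 4 * D k - lambda * (k%:R + 3) / 4 * D k.+1).
Proof.
move=> kK; have k0K := ltnW kK.
have i1 := integrable_gap kK.
have i2 := integrable_sample_gap k0K kK.
have i3 := integrable_inner kK kK k0K.
have i4 := integrableZr (lambda * (k%:R + 1) / 4) (integrable_sqd kK k0K).
have i5 := integrableZr (lambda * (k%:R + 1) / 4) (integrable_dst k0K).
have i6 := integrableZr (lambda * (k%:R + 3) / 4) (integrable_dst kK).
have i12 := integrableBr i1 i2; have i123 := integrableBr i12 i3.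
have i14 := integrableBr i123 i4; have i56 := integrableBr i5 i6.
split; first exact: (integrableDr i14 i56).
rewrite /H (RintegralD measurableT i14 i56) (RintegralB measurableT i5 i6).
rewrite (RintegralB measurableT i123 i4) (RintegralB measurableT i12 i3).
rewrite (RintegralB measurableT i1 i2) (sample_gap_mean (leqnn k) kK).
rewrite (RintegralZl _ measurableT (integrable_sqd kK k0K)).
by rewrite (RintegralZl _ measurableT (integrable_dst k0K))
  (RintegralZl _ measurableT (integrable_dst kK)).
Qed.

(** * Convergence of the weighted average *)

Lemma telescope_le (d : nat -> R) : (forall k, 0 <= d k) ->
  \sum_(0 <= k < K) (k%:R + 2) *
    (lambda * (k%:R + 1) / 4 * d k - lambda * (k%:R + 3) / 4 * d k.+1)
  <= lambda / 2 * d 0%N.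
Proof.
move=> d0.
suff -> : \sum_(0 <= k < K) (k%:R + 2) *
    (lambda * (k%:R + 1) / 4 * d k - lambda * (k%:R + 3) / 4 * d k.+1)
  = lambda / 2 * d 0%N - lambda * (K%:R + 1) * (K%:R + 2) / 4 * d K.
  rewrite lerBlDr lerDl mulr_ge0// divr_ge0// mulr_ge0 ?addr_ge0//.
  by rewrite mulr_ge0 ?addr_ge0// ltW.
elim: K => [|k IH]; first by rewrite big_geq// !add0r; field.
by rewrite big_nat_recr//= IH -(natr1 k); field.
Qed.

Lemma weight_sum (k : nat) :
  \sum_(1 <= i < k.+1) (i%:R + 1) = ((k%:R + 1) * (k%:R + 2) - 2) / 2 :> R.
Proof.
elim: k => [|k IH]; first by rewrite big_geq// !add0r; field.
by rewrite big_nat_recr//= IH -(natr1 k); field.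
Qed.

Lemma rate_le (k V d : R) : 1 <= k -> 0 <= d ->
  (k * (k + 3) / 2)^-1 *
    ((4 * k + 8 * k / (k + 1)) * (V / lambda) + lambda / 2 * d)
  <= lambda / (k + 1) ^+ 2 * d + 8 * V / (lambda * (k + 1)).
Proof.
move=> k1 d0; have l0 := lambda_gt0.
have k0 : 0 < k by lra.
have k10 : 0 < k + 1 by lra.
have k30 : 0 < k + 3 by lra.
have -> : (k * (k + 3) / 2)^-1 *
    ((4 * k + 8 * k / (k + 1)) * (V / lambda) + lambda / 2 * d)
  = lambda / (k * (k + 3)) * d + 8 * V / (lambda * (k + 1)).
  by field; rewrite !lt0r_neq0.
rewrite lerD2r ler_wpM2r// ler_pM2l// lef_pV2 ?posrE ?mulr_gt0 ?exprn_gt0//.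
by rewrite expr2; lra.
Qed.

Lemma averaged_gap_mean_le : (1 <= K)%N ->
  (\int[Pr]_w
     (objective P f phi
        ((2 / ((K%:R + 1) * (K%:R + 2) - 2)) *:
           \sum_(1 <= k < K.+1) (k%:R + 1) *: (x k w : 'rV[R]_n))%R
      - objective P f phi xstar)
   <= (lambda / (K%:R + 1) ^+ 2 * enorm (x0 - xstar) ^+ 2
       + 8 * V2 / (lambda * (K%:R + 1)))%:E)%E.
Proof.
move=> K0.
have K1 : (1 : R) <= K%:R by rewrite ler1n.
set W : R := \sum_(1 <= k < K.+1) (k%:R + 1).
have WE : W = K%:R * (K%:R + 3) / 2 by rewrite /W weight_sum; field.
have W0 : 0 < W by rewrite WE; nra.
have -> : 2 / ((K%:R + 1) * (K%:R + 2) - 2) = W^-1 :> R.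
  by rewrite WE; field; nra.
pose Y w := \sum_(0 <= k < K) W^-1 * (k%:R + 2) * H k w.
have [iY EY] := Rintegral_lincomb (fun k => W^-1 * (k%:R + 2))
  (fun k kK => (H_mean kK).1).
pose av w : 'rV[R]_n := W^-1 *: \sum_(1 <= k < K.+1) (k%:R + 1) *: pt k w.
have avP w : eff_dom phi (av w) /\
    mean_f (av w) + fine (phi (av w)) - (mean_f xstar + fine (phi xstar)) <= Y w.
  have xD k : (1 <= k <= K)%N -> eff_dom phi (pt k w).
    by case: k => // k /= kK; have [] := iterate_step w kK.
  have w0 (k : nat) : (0 : R) < k%:R + 1 by rewrite ltr_wpDl.
  have [_ [avD h]] := jensen_sum objective_convex w0 K0 xD.
  split=> //; rewrite -(ler_pM2l W0).
  rewrite mulrBr; apply: le_trans (lerB h (lexx _)) _.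
  rewrite -/W /W [in leLHS]mulr_suml -sumrB big_add1/= /Y mulr_sumr -/W.
  apply: ler_sum_nat => k /andP[_ kK].
  rewrite -mulrBr -(natr1 k) !mulrA mulfV ?lt0r_neq0// mul1r.
  have -> : k%:R + 1 + 1 = k%:R + 2 :> R by rewrite -addrA.
  by apply: ler_wpM2l; [rewrite addr_ge0|exact: H_ge].
apply: le_trans (@ge0_integral_le _ _ _ Pr _ Y _ _ iY) _.
- move=> w; have [avD _] := avP w.
  by rewrite (objectiveE avD) (objectiveE xstar_dom) -EFinB lee_fin subr_ge0 objective_min.
- move=> w; have [avD h] := avP w.
  by rewrite (objectiveE avD) (objectiveE xstar_dom) -EFinB lee_fin.
rewrite lee_fin [leLHS]EY.
have -> : \sum_(0 <= k < K) W^-1 * (k%:R + 2) * \int[Pr]_w H k w = W^-1 *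
    (\sum_(0 <= k < K) (k%:R + 2) *
       (e k.+1 - e k - c k - lambda * (k%:R + 1) / 4 * A k)
     + \sum_(0 <= k < K) (k%:R + 2) *
       (lambda * (k%:R + 1) / 4 * D k - lambda * (k%:R + 3) / 4 * D k.+1)).
  rewrite -big_split/= mulr_sumr; apply: eq_big_nat => k /andP[_ kK].
  by rewrite (H_mean kK).2 -mulrDr mulrA.
have noise := noise_sum_le sqr_bound_ge0 lambda_gt0
  (fun k => Rintegral_ge0 _ (fun w _ => sqr_ge0 _)) K0
  (fun k t kK t0 => gap_le kK (ltnW kK) t0)
  inner_le pair_gap_le.
have D_ge0 k : 0 <= D k by apply: Rintegral_ge0 => w _; exact: sqr_ge0.
have dist := telescope_le D_ge0.
have D0E : D 0%N = enorm (x0 - xstar) ^+ 2.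
  rewrite -[RHS](Rintegral_prob_cst Pr); apply: eq_Rintegral => w _.
  by rewrite (proxsps_init xP).
rewrite D0E in dist.
have Wi0 : 0 <= W^-1 by rewrite invr_ge0 ltW.
apply: le_trans (ler_wpM2l Wi0 (lerD noise dist)) _.
by rewrite WE; apply: rate_le => //; exact: sqr_ge0.
Qed.

End Convergence.


Theorem corollary5 (R : realType) (n : nat)
    (dS : measure_display) (S : measurableType dS) (P : probability S R)
    (dO : measure_display) (Omega : measurableType dO)
    (Pr : probability Omega R)
    (f : 'rV[R]_n -> S -> R) (C : S -> R) (phi : 'rV[R]_n -> \bar R)
    (lambda : R) (U : set 'rV[R]_n) (G : S -> R)
    (xstar x0 : 'rV[R]_n) (K : nat)
    (xi : nat -> {RV Pr >-> S}) (x g : nat -> {RV Pr >-> borelRn R n})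
    (f_lip : forall s, locally_lipschitz (f^~ s))
    (f_convex : forall s,
       convex_function [set: convex_lmodType 'rV[R]_n] (f^~ s))
    (f_int : forall y, P.-integrable setT (EFin \o f y))
    (f_inf : forall s, has_inf (range (f^~ s)))
    (C_le : forall s, C s <= inf (range (f^~ s)))
    (phi_proper : proper_fun phi) (phi_closed : closed_fun phi)
    (lambda_gt0 : 0 < lambda) (phi_convex : strongly_convex lambda phi)
    (U_open : open U) (U_convex : convex_set (U : set (convex_lmodType 'rV[R]_n)))
    (dom_U : eff_dom phi `<=` U)
    (G_ge0 : forall s, 0 <= G s) (G_meas : measurable_fun setT G)
    (G_L2 : ('E_P[(fun s => G s ^+ 2)%R] < +oo)%E)
    (G_bound : forall s y h, U y -> subdiff (f^~ s) y h -> enorm h <= G s)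
    (xstarP : is_argmin (objective P f phi) xstar)
    (x0_U : U x0)
    (K_gt0 : (1 <= K)%N)
    (xP : ProxSPS P f C phi (fun k => 2 / (lambda * (k%:R + 1))) x0 K xi x g) :
  let GG := Num.sqrt (fine ('E_P[(fun s => G s ^+ 2)%R])%E) in
  (\int[Pr]_w
     (objective P f phi
        ((2 / ((K%:R + 1) * (K%:R + 2) - 2)) *:
           \sum_(1 <= k < K.+1) (k%:R + 1) *: (x k w : 'rV[R]_n))%R
      - objective P f phi xstar)
   <= (lambda / (K%:R + 1) ^+ 2 * enorm (x0 - xstar) ^+ 2
       + 8 * GG ^+ 2 / (lambda * (K%:R + 1)))%:E)%E.
Proof.
rewrite /= sqr_sqrtr sqr_boundE; last exact: sqr_bound_ge0.
exact: (averaged_gap_mean_le f_lip f_convex f_int f_inf phi_proper phi_convex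
  lambda_gt0 U_open dom_U G_ge0 G_meas G_L2 G_bound xstarP C_le x0_U xP K_gt0).
Qed.
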